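(* Let $I$ be an open interval containing $[0,1]$ and let $f:I\to\mathbb{R}$ be twice differentiable on $I$ with bounded second derivative, and suppose $f>2$. Fix $\varepsilon\in\mathbb{R}$ and, for each positive integer $n$ large enough that the points below lie in $I$, let $T_n(f;\varepsilon)$ be the $n\times n$ tridiagonal matrix with diagonal entries \[ f\left(\tfrac{\varepsilon}{n}\right),\ f\left(\tfrac{1+\varepsilon}{n}\right),\ f\left(\tfrac{2+\varepsilon}{n}\right),\ \dots,\ f\left(\tfrac{n-1+\varepsilon}{n}\right) \] (i.e. the $(j,j)$ entry is $f\left(\frac{j-1+\varepsilon}{n}\right)$ for $j=1,\dots,n$), all super- and sub-diagonal entries equal to $-1$, and all other entries $0$. Let \[ G(f)=\exp\left\{\int_0^1 \log\left(\frac{f(x)+\sqrt{f^2(x)-4}}{2}\right)dx\right\}. \] Then \[ \lim_{n\to\infty}\frac{\det T_n(f;\varepsilon)}{G(f)^n}=\frac{\left(f(0)+\sqrt{f^2(0)-4}\right)^{1-\varepsilon}\left(f(1)+\sqrt{f^2(1)-4}\right)^{\varepsilon}}{2\sqrt[4]{(f^2(0)-4)(f^2(1)-4)}}. \] *)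

(* Defs.v *)
From HB Require Import structures.
From mathcomp Require Import all_boot all_order all_algebra.
From mathcomp Require Import all_classical all_reals all_analysis.
Set Implicit Arguments. Unset Strict Implicit. Unset Printing Implicit Defensive.
Import Order.TTheory GRing.Theory Num.Theory numFieldNormedType.Exports.
Local Open Scope ring_scope.

(* T_n(f; eps): n x n tridiagonal matrix; 0-indexed row i has diagonal entry
   f((i + eps)/n)  (= f((j-1+eps)/n) for 1-indexed j), off-diagonals -1. *)
Definition Tmat (R : realType) (f : R -> R) (eps : R) (n : nat) : 'M[R]_n :=
  \matrix_(i < n, j < n)
    if i == j then f ((i%:R + eps) / n%:R)
    else if (i.+1 == j :> nat) || (j.+1 == i :> nat) then -1 else 0.

Definition Gf (R : realType) (f : R -> R) : R :=
  expR (Rintegral (@lebesgue_measure R) `[0%R, 1%R]%classic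
          (fun x => ln ((f x + Num.Def.sqrtr (f x ^+ 2 - 4)) / 2))).

(* Main.v *)
Require Import Defs.
From HB Require Import structures.
From mathcomp Require Import all_boot all_order all_algebra.
From mathcomp Require Import all_classical all_reals all_analysis.
From mathcomp Require Import ring lra zify.
Import Order.TTheory GRing.Theory Num.Theory numFieldNormedType.Exports.
Local Open Scope ring_scope.
Local Open Scope classical_set_scope.

(* Write f = r + 1/r with r > 1, m = 1/r and x_k = (k - 1 + eps)/n.  The leading
   principal minors D_k of T_n satisfy D_k = f(x_k) D_(k-1) - D_(k-2), so that
   a_k = D_k m(x_1) ... m(x_k) and d_k = a_k - a_(k-1) satisfy
     d_(k+1) = m(x_(k+1)) m(x_k) d_k + a_k m(x_(k+1)) (m(x_(k+1)) - m(x_k)).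
   Since m <= rho < 1, this contracts d_k down to O(1/n) at a geometric rate, while
   (a_k - m(x_k) m(x_(k+1)) a_(k-1)) / sqrt (1 - m(x_k)^2) stays constant up to
   O(1/n): each step changes it by O(1/n^2 + |d_k|/n), because m has a Lipschitz
   derivative.  At k = 0 this quantity is 1 / sqrt (1 - m(x_0)^2) and at k = n it is
   a_n sqrt (1 - m(x_n)^2) + o(1), so
   a_n -> 1 / sqrt ((1 - m(0)^2) (1 - m(1)^2)).
   Finally r(x_1) ... r(x_n) / G(f)^n -> (r(1)/r(0))^(eps - 1/2), by a second order
   Taylor expansion of a primitive of ln r on each [i/n, (i+1)/n]. *)

(** * Determinants of tridiagonal matrices *)

(** The diagonal is a sequence independent of the size, so the leading principal minors are the
    determinants of the same family at smaller sizes. [Tmat f eps n] is the case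
    [d i = f ((i + eps) / n)]. *)
Definition tridiag (R : comNzRingType) (d : nat -> R) (n : nat) : 'M[R]_n :=
  \matrix_(i < n, j < n)
    if i == j then d i
    else if (i.+1 == j :> nat) || (j.+1 == i :> nat) then -1 else 0.

(** The last row has only two nonzero entries. The minor of its [-1] has a single nonzero entry in
    its last column, again [-1], and leaves the matrix of size [n]. *)
Lemma det_tridiagSS (R : comNzRingType) (d : nat -> R) n :
  \det (tridiag R d n.+2) =
  d n.+1 * \det (tridiag R d n.+1) - \det (tridiag R d n).
Proof.
rewrite (expand_det_row _ ord_max) 2!big_ord_recr /= big1 ?add0r; last first.
  move=> i _; rewrite mxE -val_eqE /= gtn_eqF ?ifF ?mul0r //; first by have := ltn_ord i; lia.
  by have := ltn_ord i; lia.
rewrite addrC; congr (_ + _).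
  rewrite mxE eqxx /cofactor -signr_odd addnn odd_double mul1r.
  congr (_ * \det _); apply/matrixP => i j.
  by rewrite !mxE -!val_eqE /= /bump !(leqNgt n.+1) !ltn_ord !add0n.
rewrite mxE -val_eqE /= gtn_eqF //= eqxx orbT.
rewrite /cofactor /= addSn addnn -signr_odd /= odd_double expr1 !mulN1r opprK.
rewrite (expand_det_col _ ord_max) big_ord_recr /= big1 ?add0r; last first.
  move=> i _; rewrite !mxE -val_eqE /= /bump.
  have := ltn_ord i => ltin.
  by rewrite ltn_eqF ?ifF ?mul0r //; lia.
rewrite !mxE -val_eqE /= /bump ltn_eqF; last by lia.
rewrite ifT; last by lia.
rewrite /cofactor addnn -signr_odd odd_double mul1r mulN1r.
congr (- \det _); apply/matrixP => i j.
have := ltn_ord i; have := ltn_ord j => ltj lti.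
rewrite !mxE -!val_eqE /= /bump.
have ni : (n < i)%N = false by lia.
have nj : (n <= j)%N = false by lia.
have ni' : (n <= i)%N = false by lia.
by rewrite !(ni', nj, add0n, ni).
Qed.

(** * The amplitude recurrence *)

(** The two bounds depend on each other, so a weighted sum [|a k| + K * |d k|] is controlled first.
    It grows by a factor at most [1 + x] per step with [x = C * h / (1 - rho)], and [n * h <= 1]
    keeps the product below an exponential. *)
Lemma perturbed_geometric_bound (R : realType) (rho C h : R) (n : nat)
    (a d : nat -> R) :
  0 <= rho < 1 -> 0 <= C -> 0 <= h -> n%:R * h <= 1 ->
  a 0%N = 1 -> d 0%N = 1 ->
  (forall k, (k < n)%N -> a k.+1 = a k + d k.+1) ->
  (forall k, (k < n)%N -> `|d k.+1| <= rho * `|d k| + C * h * `|a k|) ->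
  forall k, (k <= n)%N ->
    `|a k| <= expR (C / (1 - rho)) / (1 - rho) /\
    `|d k| <= rho ^+ k +
      C * (expR (C / (1 - rho)) / (1 - rho)) / (1 - rho) * h.
Proof.
move=> /andP[rho0 rho1] C0 h0 nh a0 d0 aS dS.
have c0 : 0 < 1 - rho by lra.
(* This weight solves [(1 + K) * rho = K]: what [d k] contributes to step [k.+1], through [a] and
   [d] together, is at most the [K * |d k|] already counted. *)
pose K := rho / (1 - rho).
have K0 : 0 <= K by rewrite divr_ge0 // ltW.
have K1 : 1 + K = (1 - rho)^-1 by rewrite /K; field; lra.
have KE : (1 + K) * rho = K by rewrite K1 mulrC.
pose x := C / (1 - rho) * h.
have x0 : 0 <= x by rewrite !mulr_ge0 // invr_ge0 ltW.
have S k : (k <= n)%N -> `|a k| + K * `|d k| <= (1 + x) ^+ k * (1 - rho)^-1.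
  elim: k => [_|k IH kn]; first by rewrite a0 d0 !normr1 mulr1 K1 mul1r.
  have Dk := dS _ kn.
  have {}IH := IH (ltnW kn).
  have nd := normr_ge0 (d k); have na := normr_ge0 (a k).
  apply: (@le_trans _ _ ((1 + x) * (`|a k| + K * `|d k|))); last first.
    by rewrite exprS -mulrA ler_wpM2l //; lra.
  have T : `|a k.+1| <= `|a k| + `|d k.+1| by rewrite aS // ler_normD.
  have M : (1 + K) * `|d k.+1| <= (1 + K) * (rho * `|d k| + C * h * `|a k|).
    by rewrite ler_wpM2l //; lra.
  have EM : (1 + K) * (rho * `|d k| + C * h * `|a k|) = K * `|d k| + x * `|a k|.
    by rewrite mulrDr mulrA KE; congr (_ + _); rewrite K1 /x; ring.
  have : 0 <= x * (K * `|d k|) := mulr_ge0 x0 (mulr_ge0 K0 nd).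
  by lra.
pose A := expR (C / (1 - rho)) / (1 - rho).
have A0 : 0 <= A by rewrite divr_ge0 ?expR_ge0 // ltW.
have aA k : (k <= n)%N -> `|a k| <= A.
  move=> kn; apply: (@le_trans _ _ ((1 + x) ^+ k * (1 - rho)^-1)).
    by apply: le_trans (S k kn); rewrite lerDl mulr_ge0.
  rewrite /A; apply: ler_wpM2r; first by rewrite invr_ge0 ltW.
  apply: (@le_trans _ _ (expR x ^+ k)).
    by apply: lerXn2r; rewrite ?nnegrE ?expR_ge0 ?expR_ge1Dx //; lra.
  rewrite -expRM_natl ler_expR /x mulrCA; apply: ler_piMr; first by rewrite divr_ge0 // ltW.
  by apply: le_trans nh; apply: ler_wpM2r => //; rewrite ler_nat.
move=> k kn; split; first exact: aA.
(* [C * A / (1 - rho)] is the fixed point of [t => rho * t + C * A], so the bound reproduces itself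
   at each step. *)
rewrite -/A; elim: k kn => [_|k IH kn].
  by rewrite d0 normr1 expr0 lerDl !mulr_ge0 // invr_ge0 ltW.
have {}IH := IH (ltnW kn); have Dk := dS _ kn.
have Ak := aA _ (ltnW kn).
have M1 : rho * `|d k| <= rho * (rho ^+ k + C * A / (1 - rho) * h).
  exact: ler_wpM2l.
have M2 : C * h * `|a k| <= C * h * A by rewrite ler_wpM2l // mulr_ge0.
apply: le_trans Dk _; apply: le_trans (lerD M1 M2) _.
rewrite mulrDr -exprS -addrA lerD2l le_eqVlt; apply/orP; left; apply/eqP.
by field; lra.
Qed.

(* For the recurrence of [det_tridiag_amplitude], the quantity
   [e = (1 - m0 * m1) * a + m0 * m1 * d] increases by exactly
   [a * m1 * (m1 - m2)]; dividing it by [E = sqrt (1 - m ^ 2)] makes this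
   increment of second order. *)
Lemma invariant_step (R : realType) (A C h c m0 m1 m2 E0 E1 a d : R) :
  0 < c -> 0 <= C -> 0 <= h ->
  0 <= m0 <= 1 -> 0 <= m1 <= 1 ->
  `|m1 - m0| <= C * h -> `|2 * m1 - m2 - m0| <= C * h ^+ 2 ->
  c <= E0 <= 1 -> c <= E1 <= 1 -> E0 ^+ 2 = 1 - m0 ^+ 2 -> E1 ^+ 2 = 1 - m1 ^+ 2 ->
  `|a| <= A ->
  `|((1 - m0 * m1) * a + m0 * m1 * d + a * m1 * (m1 - m2)) / E1
    - ((1 - m0 * m1) * a + m0 * m1 * d) / E0| <=
  (A * (C + C ^+ 2 / 2 + (C / c) ^+ 2 / 2) * h ^+ 2
   + (C * h * A + `|d|) * (C / c * h)) / c ^+ 2.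
Proof.
move=> c0 C0 h0 /andP[m00 m01] /andP[m10 m11] D1 D2 /andP[cE0 E01] /andP[cE1 E11] E0s E1s aA.
have E0p : 0 < E0 by lra.
have E1p : 0 < E1 by lra.
(* [r] is the defect in [e = E0 ^+ 2 * a + r]; it is of size [h + |d|]. *)
pose r := (m0 ^+ 2 - m0 * m1) * a + m0 * m1 * d.
pose D := E1 - E0.
have eE : (1 - m0 * m1) * a + m0 * m1 * d = E0 ^+ 2 * a + r.
  by rewrite E0s /r; ring.
have A0 : 0 <= A by apply: le_trans aA.
have rle : `|r| <= C * h * A + `|d|.
  apply: le_trans (ler_normD _ _) _; apply: lerD.
    have -> : m0 ^+ 2 - m0 * m1 = - (m0 * (m1 - m0)) by ring.
    rewrite normrM normrN normrM (ger0_norm m00).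
    apply: ler_pM => //; first by rewrite mulr_ge0.
    by apply: le_trans D1; rewrite ler_piMl.
  by rewrite normrM ger0_norm ?mulr_ge0 // ler_piMl // mulr_ile1.
have Dle : `|D| <= C / c * h.
  have -> : D = (m0 - m1) * ((m0 + m1) / (E0 + E1)).
    rewrite /D; apply: (@mulIf _ (E0 + E1)); first by lra.
    rewrite -mulrA mulfVK; last by lra.
    have -> : (E1 - E0) * (E0 + E1) = E1 ^+ 2 - E0 ^+ 2 by ring.
    by rewrite E0s E1s; ring.
  rewrite normrM -(mulrA C) [c^-1 * h]mulrC mulrA; apply: ler_pM => //.
    by rewrite distrC.
  rewrite ger0_norm ?divr_ge0; [|lra..].
  by rewrite ler_pdivrMr ?ler_pdivlMl; [nra|lra..].
have [[rn Dn] an] := ((normr_ge0 r, normr_ge0 D), normr_ge0 a).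
(* Numerator of the difference of quotients, after replacing [E0 * D] by
   [(m0 ^+ 2 - m1 ^+ 2 - D ^+ 2) / 2]. The first order terms combine into the second difference of
   [m]; the rest are squares of first differences and [r * D]. *)
pose N := a * E0 * (m1 * (2 * m1 - m2 - m0) - (m1 - m0) ^+ 2 / 2 + D ^+ 2 / 2)
   - r * D.
have -> : ((1 - m0 * m1) * a + m0 * m1 * d + a * m1 * (m1 - m2)) / E1
    - ((1 - m0 * m1) * a + m0 * m1 * d) / E0 = N / (E1 * E0).
  rewrite eE; apply: (@mulIf _ (E1 * E0)); first by apply: mulf_neq0; lra.
  rewrite mulfVK; last by apply: mulf_neq0; lra.
  have -> : ((E0 ^+ 2 * a + r + a * m1 * (m1 - m2)) / E1 - (E0 ^+ 2 * a + r) / E0)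
    * (E1 * E0) = (a * m1 * (m1 - m2)) * E0 - (E0 ^+ 2 * a + r) * D.
    by rewrite /D; field; apply/andP; split; lra.
  have -> : E0 ^+ 2 * a = a * E0 * E0 by ring.
  have ED : E0 * D = (m0 ^+ 2 - m1 ^+ 2 - D ^+ 2) / 2.
    have -> : m0 ^+ 2 - m1 ^+ 2 = E1 ^+ 2 - E0 ^+ 2 by rewrite E0s E1s; ring.
    by rewrite /D; field.
  have -> : (a * E0 * E0 + r) * D = a * E0 * (E0 * D) + r * D by ring.
  by rewrite ED /N; field.
rewrite normrM; apply: ler_pM => //; last first.
  rewrite ger0_norm; last by rewrite invr_ge0 mulr_ge0 //; lra.
  by rewrite lef_pV2 ?posrE ?exprn_gt0 ?mulr_gt0 // expr2 ler_pM //; lra.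
apply: le_trans (ler_normB _ _) _; apply: lerD; last first.
  by rewrite normrM; apply: ler_pM.
rewrite normrM -mulrA; apply: ler_pM => //.
  by rewrite normrM (ger0_norm (ltW E0p)); apply: le_trans aA; rewrite ler_piMr.
apply: le_trans (ler_normD _ _) _; rewrite 2!(mulrDl _ _ (h ^+ 2)); apply: lerD.
  apply: le_trans (ler_normB _ _) _; apply: lerD.
    by rewrite normrM (ger0_norm m10); apply: le_trans D2; rewrite ler_piMl.
  rewrite normrM normrX [`|2^-1|]ger0_norm // (mulrAC (_ ^+ 2) 2^-1 (h ^+ 2)) ler_pM2r // -exprMn.
  by apply: lerXn2r => //; rewrite nnegrE // mulr_ge0.
rewrite normrM normrX [`|2^-1|]ger0_norm // (mulrAC (_ ^+ 2) 2^-1 (h ^+ 2)) ler_pM2r // -exprMn.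
by apply: lerXn2r => //; rewrite nnegrE mulr_ge0 // divr_ge0 // ltW.
Qed.

Lemma telescoping_geometric_bound (R : numFieldType) (rho u v : R) (n : nat)
    (g : nat -> R) :
  rho != 1 ->
  (forall k, (k < n)%N -> `|g k.+1 - g k| <= u + v * rho ^+ k) ->
  `|g n - g 0%N| <= n%:R * u + v * ((1 - rho ^+ n) / (1 - rho)).
Proof.
move=> rho1; elim: n => [_|n IH gS].
  by rewrite subrr normr0 expr0 subrr mul0r mul0r mulr0 addr0.
rewrite -(subrKA (g n)); apply: le_trans (ler_normD _ _) _.
apply: le_trans (lerD (gS n (ltnSn n)) (IH _)) _.
  by move=> k kn; apply: gS; apply: ltnW.
have -> : (1 - rho ^+ n.+1) / (1 - rho) = rho ^+ n + (1 - rho ^+ n) / (1 - rho).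
  by rewrite exprS; field; rewrite subr_eq0 eq_sym.
by rewrite -natr1 !mulrDl mul1r mulrDr -!addrA le_eqVlt; apply/orP; left; apply/eqP; ring.
Qed.

(** [K] is chosen before [n] because the sequences [m], [a], [d] all change with [n] in the
    application. The values of [m] run up to index [n.+1] because [e k] below involves [m k.+1]. *)
Lemma amplitude_asymptotics (R : realType) (rho C : R) :
  0 <= rho < 1 -> 0 <= C ->
  exists2 K : R, 0 <= K & forall (n : nat) (h : R) (m a d : nat -> R),
    n%:R * h = 1 -> 0 <= h ->
    (forall k, (k <= n.+1)%N -> 0 <= m k <= rho) ->
    (forall k, (k <= n)%N -> `|m k.+1 - m k| <= C * h) ->
    (forall k, (k < n)%N -> `|2 * m k.+1 - m k.+2 - m k| <= C * h ^+ 2) ->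
    a 0%N = 1 -> d 0%N = 1 ->
    (forall k, (k < n)%N -> a k.+1 = a k + d k.+1) ->
    (forall k, (k < n)%N ->
      d k.+1 = m k.+1 * m k * d k + a k * m k.+1 * (m k.+1 - m k)) ->
    `|a n * (Num.sqrt (1 - m 0%N ^+ 2) * Num.sqrt (1 - m n ^+ 2)) - 1|
      <= K * (h + rho ^+ n).
Proof.
move=> rho01 C0; have /andP[rho0 rho1] := rho01.
pose c := 1 - rho; have c0 : 0 < c by rewrite /c; lra.
pose A := expR (C / c) / c; have A0 : 0 <= A := divr_ge0 (expR_ge0 _) (ltW c0).
pose B := C / c; have B0 : 0 <= B := divr_ge0 C0 (ltW c0).
pose D := C * A / c; have D0 : 0 <= D := divr_ge0 (mulr_ge0 C0 A0) (ltW c0).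
(* Coefficient of [h ^+ 2] in the bound of [invariant_step] once [|d k| <= rho ^+ k + D * h] is
   inserted; the part with [rho ^+ k] is kept separate, as it sums to a geometric series. *)
pose K1 := (A * (C + C ^+ 2 / 2 + B ^+ 2 / 2) + (C * A + D) * B) / c ^+ 2.
have CA0 : 0 <= C * A by exact: mulr_ge0.
have c20 : 0 <= c ^+ 2 by exact: sqr_ge0.
have K10 : 0 <= K1.
  apply: divr_ge0 => //; apply: addr_ge0; last by apply: mulr_ge0 => //; exact: addr_ge0.
  apply: mulr_ge0 => //; have := sqr_ge0 C; have := sqr_ge0 B; lra.
pose K2 := K1 + B / c ^+ 2 / c.
have K20 : 0 <= K2.
  by apply: addr_ge0 => //; apply: divr_ge0 (ltW c0); exact: divr_ge0.
exists (K2 + (C * A + D + 1) / c).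
  by apply: addr_ge0 => //; apply: divr_ge0 (ltW c0); lra.
move=> n h m a d nh h0 mrho dm ddm a0 d0 aS dS.
pose E k := Num.sqrt (1 - m k ^+ 2).
have m01 k : (k <= n.+1)%N -> 0 <= m k <= 1.
  by move=> /mrho /andP[-> /= /le_trans]; apply; exact: ltW.
have Es k : (k <= n.+1)%N -> E k ^+ 2 = 1 - m k ^+ 2.
  by move=> /m01 /andP[m0 m1]; rewrite sqr_sqrtr // subr_ge0 expr_le1.
have Ec k : (k <= n.+1)%N -> c <= E k <= 1.
  move=> kn; have /andP[m0 m1] := mrho _ kn.
  have E0 : 0 <= E k by exact: sqrtr_ge0.
  have := Es _ kn => Ek; apply/andP; split.
    rewrite -(@ler_pXn2r _ 2) // ?nnegrE ?(ltW c0) // Ek /c; nra.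
  by rewrite -(@ler_pXn2r _ 2) // ?nnegrE // Ek expr1n; nra.
have dn k : (k < n)%N -> `|d k.+1| <= rho * `|d k| + C * h * `|a k|.
  move=> kn; rewrite dS //; apply: le_trans (ler_normD _ _) _; apply: lerD.
    rewrite normrM ler_wpM2r //.
    have /andP[mk0 mk1] := m01 k (leqW (ltnW kn)).
    have /andP[mS0 mS1] := mrho k.+1 (leqW kn).
    by rewrite ger0_norm ?mulr_ge0 // -[leRHS]mulr1 ler_pM.
  rewrite -mulrA normrM mulrC ler_wpM2r // normrM -[leRHS]mul1r.
  have /andP[mS0 mS1] := m01 k.+1 (leqW kn).
  by apply: ler_pM => //; [rewrite ger0_norm | exact: dm (ltnW kn)].
have nh1 : n%:R * h <= 1 by rewrite nh.
have ad := @perturbed_geometric_bound R rho C h n a d rho01 C0 h0 nh1 a0 d0 aS dn.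
have aA k : (k <= n)%N -> `|a k| <= A by case/ad.
have dD k : (k <= n)%N -> `|d k| <= rho ^+ k + D * h by case/ad.
pose e k := (1 - m k * m k.+1) * a k + m k * m k.+1 * d k.
have eS k : (k < n)%N -> e k.+1 = e k + a k * m k.+1 * (m k.+1 - m k.+2).
  by move=> kn; rewrite /e aS // dS //; ring.
pose g k := e k / E k.
have gS k : (k < n)%N -> `|g k.+1 - g k| <= K1 * h ^+ 2 + B * h / c ^+ 2 * rho ^+ k.
  move=> kn; rewrite /g eS //.
  have kn1 := leqW kn; have kn0 := ltnW kn1; have knw := ltnW kn.
  have := @invariant_step R A C h c (m k) (m k.+1) (m k.+2) (E k) (E k.+1)
    (a k) (d k) c0 C0 h0 (m01 _ kn0) (m01 _ kn1) (dm _ knw) (ddm _ kn)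
    (Ec _ kn0) (Ec _ kn1) (Es _ kn0) (Es _ kn1) (aA _ knw).
  move=> /le_trans; apply.
  apply: (@le_trans _ _ ((A * (C + C ^+ 2 / 2 + B ^+ 2 / 2) * h ^+ 2
     + (C * h * A + (rho ^+ k + D * h)) * (B * h)) / c ^+ 2)).
    apply: ler_wpM2r; first by rewrite invr_ge0.
    rewrite lerD2l; apply: ler_wpM2r; first exact: mulr_ge0.
    by rewrite lerD2l dD.
  rewrite le_eqVlt; apply/orP; left; apply/eqP; rewrite /K1.
  by field; lra.
have rhon : 0 <= rho ^+ n by rewrite exprn_ge0.
have gn : `|g n - g 0%N| <= K2 * h.
  have rhone1 : rho != 1 by rewrite lt_eqF.
  apply: le_trans (@telescoping_geometric_bound _ _ _ _ _ _ rhone1 gS) _.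
  (* The [n] increments of order [h ^+ 2] add up to order [h], since [n * h = 1]. *)
  have -> : n%:R * (K1 * h ^+ 2) = K1 * h * (n%:R * h) by ring.
  rewrite nh mulr1 /K2 (mulrDl K1) lerD2l.
  have -> : B / c ^+ 2 / c * h = B * h / c ^+ 2 * (1 / c) by rewrite mul1r; ring.
  apply: ler_wpM2l; first by apply: divr_ge0 => //; exact: mulr_ge0.
  by apply: ler_wpM2r; [rewrite invr_ge0 ltW | lra].
have e0 : e 0%N = 1 by rewrite /e a0 d0; ring.
have nn1 : (n <= n.+1)%N by exact: leqnSn.
have /andP[mn0 mn1] := m01 n nn1.
have /andP[mS0 mS1] := m01 n.+1 (leqnn _).
have /andP[cn En1] := Ec n nn1.
have /andP[cE0 E01] := Ec 0%N (leq0n _).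
have E0p : 0 < E 0%N by lra.
have Enp : 0 < E n by lra.
(* At the last index [e n] is [E n ^+ 2 * a n] up to [r], which is small because [m n - m n.+1] is
   of order [h] and [d n] has decayed to [rho ^+ n + D * h]. *)
pose r := m n * (m n - m n.+1) * a n + m n * m n.+1 * d n.
have en : e n = E n ^+ 2 * a n + r by rewrite Es // /e /r; ring.
have rle : `|r| <= C * h * A + (rho ^+ n + D * h).
  apply: le_trans (ler_normD _ _) _; apply: lerD.
    rewrite !normrM; apply: ler_pM => //; last exact: aA.
    rewrite (ger0_norm mn0) -[leRHS]mul1r; apply: ler_pM => //.
    by rewrite distrC dm.
  rewrite normrM ger0_norm ?mulr_ge0 // -[leRHS]mul1r; apply: ler_pM => //.
  - by rewrite mulr_ge0.
  - by rewrite mulr_ile1.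
  - exact: dD.
have -> : a n * (E 0%N * E n) - 1 = E 0%N * (g n - g 0%N - r / E n).
  by rewrite /g e0 en; field; apply/andP; split; lra.
rewrite normrM (ger0_norm (ltW E0p)); apply: le_trans (ler_piMl _ E01) _ => //.
apply: le_trans (ler_normB _ _) _.
have rE : `|r / E n| <= (C * h * A + (rho ^+ n + D * h)) / c.
  rewrite normrM; apply: ler_pM => //.
  by rewrite normfV (ger0_norm (ltW Enp)) lef_pV2.
apply: le_trans (lerD gn rE) _.
rewrite (mulrDl K2); apply: lerD; first by apply: ler_wpM2l => //; lra.
rewrite (mulrAC _ c^-1 (h + _)); apply: ler_wpM2r; first by rewrite invr_ge0 ltW.
have : 0 <= (C * A + D) * rho ^+ n by rewrite mulr_ge0 // addr_ge0 // mulr_ge0.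
by lra.
Qed.

(** The three-term recurrence of the minors, with [f = m + 1 / m] and the product of the [m]
    absorbed. Row [k] carries [m k.+1]; [m 0] belongs to the point just before the first node. The
    value [d 0 = 1] amounts to a minor [0] at index [-1]. *)
Lemma det_tridiag_amplitude (R : fieldType) (f m : nat -> R) (n : nat) :
  (forall k, (k <= n)%N -> m k != 0) ->
  (forall k, (k < n)%N -> f k = m k.+1 + (m k.+1)^-1) ->
  let a k := \det (tridiag R f k) * \prod_(i < k) m i.+1 in
  let d k := if k is j.+1 then a k - a j else 1 in
  forall k, (k < n)%N ->
    d k.+1 = m k.+1 * m k * d k + a k * m k.+1 * (m k.+1 - m k).
Proof.
move=> m0 fm a d [|k] kn.
  rewrite /d /a big_ord_recr !big_ord0 /= !mul1r det_mx00 det_mx11 mxE eqxx /=.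
  by rewrite fm //; field; exact: m0.
rewrite /d /a det_tridiagSS !big_ord_recr /= fm //.
by field; apply: m0.
Qed.

(** * Taylor expansions with Lipschitz derivatives *)

(** A mean value theorem for either order of [x] and [y], needed because the shift [eps] may have
    any sign; the bound on [|c - x|] is what the Taylor estimates use. *)
Lemma MVT_between (R : realType) (g dg : R -> R) (a b x y : R) :
  (forall z, a < z < b -> is_derive z 1 g (dg z)) ->
  a < x < b -> a < y < b ->
  exists c, [/\ a < c < b, `|c - x| <= `|y - x| & g y - g x = dg c * (y - x)].
Proof.
move=> dgP.
have le_case u v : a < u < b -> a < v < b -> u <= v ->
    exists2 c, u <= c <= v & g v - g u = dg c * (v - u).
  move=> /andP[au ub] /andP[av vb] uv.
  have dguv z : z \in `[u, v]%R -> is_derive z 1 g (dg z).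
    by rewrite in_itv /= => /andP[uz zv]; apply: dgP; lra.
  have dg_oo z : z \in `]u, v[%R -> is_derive z 1 g (dg z).
    by rewrite in_itv /= => uzv; apply: dgP; lra.
  have cg : {within `[u, v], continuous g}.
    by apply: derivable_within_continuous => z /dguv dz; exact: ex_derive.
  have [c] := MVT_segment uv dg_oo cg.
  by rewrite in_itv /= => cuv E; exists c.
move=> xab yab; have [xy|/ltW yx] := leP x y.
  have [c /andP[xc cy] E] := le_case _ _ xab yab xy.
  exists c; split => //; first by lra.
  by rewrite !ger0_norm; lra.
have [c /andP[yc cx] E] := le_case _ _ yab xab yx.
exists c; split => //; first by lra.
  by rewrite !ler0_norm; lra.
by rewrite -opprB E; ring.
Qed.

Definition bounded_oo (R : realType) (a b : R) (g : R -> R) :=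
  exists2 K : R, 0 <= K & forall x, a < x < b -> `|g x| <= K.

Definition lipschitz_oo (R : realType) (a b : R) (g : R -> R) :=
  exists2 K : R, 0 <= K &
    forall x y, a < x < b -> a < y < b -> `|g y - g x| <= K * `|y - x|.

Lemma bounded_derive_lipschitz (R : realType) (a b : R) (g dg : R -> R) :
  (forall z, a < z < b -> is_derive z 1 g (dg z)) ->
  bounded_oo R a b dg -> lipschitz_oo R a b g.
Proof.
move=> dgP [K K0 gK]; exists K => // x y xab yab.
have [c [cab _ ->]] := @MVT_between R g dg a b x y dgP xab yab.
by rewrite normrM; apply: ler_wpM2r => //; exact: gK.
Qed.

Lemma lipschitz_bounded (R : realType) (a b : R) (g : R -> R) :
  a < b -> lipschitz_oo R a b g -> bounded_oo R a b g.
Proof.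
move=> ab [K K0 gK]; pose m := (a + b) / 2.
have mab : a < m < b by rewrite /m; lra.
exists (`|g m| + K * (b - a)); first by rewrite addr_ge0 // mulr_ge0 //; lra.
move=> x xab; rewrite -(subrK (g m) (g x)) addrC.
apply: le_trans (ler_normD _ _) _; rewrite lerD2l.
apply: le_trans (gK _ _ mab xab) _; apply: ler_wpM2l => //.
by rewrite ler_norml /m; lra.
Qed.

Lemma lipschitz_mul (R : realType) (a b : R) (g k : R -> R) : a < b ->
  lipschitz_oo R a b g -> lipschitz_oo R a b k ->
  lipschitz_oo R a b (fun x => g x * k x).
Proof.
move=> ab lg lk; have [Bg Bg0 gB] := @lipschitz_bounded _ _ _ _ ab lg.
have [Bk Bk0 kB] := @lipschitz_bounded _ _ _ _ ab lk.
case: lg => Kg Kg0 gK; case: lk => Kk Kk0 kK.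
exists (Kg * Bk + Bg * Kk); first by rewrite addr_ge0 ?mulr_ge0.
move=> x y xab yab.
have -> : g y * k y - g x * k x = (g y - g x) * k y + g x * (k y - k x) by ring.
apply: le_trans (ler_normD _ _) _; rewrite !normrM mulrDl; apply: lerD.
  by rewrite mulrAC; apply: ler_pM => //; [exact: gK|exact: kB].
by rewrite -mulrA; apply: ler_pM => //; [exact: gB|exact: kK].
Qed.

Lemma lipschitz_inv_sqrt (R : realType) (a b sigma : R) (g : R -> R) :
  0 < sigma -> (forall x, a < x < b -> sigma <= g x) ->
  lipschitz_oo R a b g -> lipschitz_oo R a b (fun x => (Num.sqrt (g x))^-1).
Proof.
move=> sigma0 sg [K K0 gK]; pose t := Num.sqrt sigma.
have t0 : 0 < t by rewrite sqrtr_gt0.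
have tg x : a < x < b -> t <= Num.sqrt (g x) by move=> /sg; exact: ler_wsqrtr.
(* From [1/q - 1/p = - (q ^+ 2 - p ^+ 2) / ((q + p) * q * p)] with [p, q >= t]. *)
exists (K * (2 * t)^-1 * (t * t)^-1).
  by rewrite !mulr_ge0 // invr_ge0 ltW // mulr_gt0.
move=> x y xab yab.
have tx := tg _ xab; have ty := tg _ yab.
have sx : Num.sqrt (g x) ^+ 2 = g x.
  by rewrite sqr_sqrtr //; have := sg _ xab; lra.
have sy : Num.sqrt (g y) ^+ 2 = g y.
  by rewrite sqr_sqrtr //; have := sg _ yab; lra.
have gxy := gK _ _ xab yab.
move: tx ty sx sy; set p := Num.sqrt (g x); set q := Num.sqrt (g y) => tx ty sx sy.
have -> : q^-1 - p^-1 = - (g y - g x) * (q + p)^-1 * (q * p)^-1.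
  by rewrite -sx -sy; field; apply/and3P; split; lra.
have -> : K / (2 * t) / (t * t) * `|y - x| = K * `|y - x| / (2 * t) / (t * t) by ring.
rewrite !normrM normrN normfV [X in _ * X]normfV.
have tt0 : 0 < t * t by exact: mulr_gt0.
have ttqp : t * t <= q * p by apply: ler_pM; lra.
apply: ler_pM => //; last by rewrite lef_pV2 ?posrE // ger0_norm; lra.
apply: ler_pM => //; last by rewrite ger0_norm ?lef_pV2 ?posrE; lra.
Qed.

Lemma taylor1_lipschitz (R : realType) (a b K : R) (g dg : R -> R) :
  0 <= K -> (forall z, a < z < b -> is_derive z 1 g (dg z)) ->
  (forall x y, a < x < b -> a < y < b -> `|dg y - dg x| <= K * `|y - x|) ->
  forall x h, a < x < b -> a < x + h < b ->
  `|g (x + h) - g x - h * dg x| <= K * h ^+ 2.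
Proof.
move=> K0 dgP dgK x h xab yab.
have [c [cab cx ->]] := @MVT_between R g dg a b x (x + h) dgP xab yab.
have E : x + h - x = h by ring.
rewrite E in cx *; rewrite mulrC -mulrBr normrM -real_normK ?num_real // expr2 mulrCA.
apply: ler_wpM2l => //; apply: le_trans (dgK _ _ xab cab) _.
exact: ler_wpM2l.
Qed.

(** The derivative of the second order remainder of [F] is the first order remainder of [g]; the
    mean value theorem turns the quadratic bound on the latter into a cubic one. *)
Lemma taylor2_lipschitz (R : realType) (a b K : R) (F g dg : R -> R) :
  0 <= K -> (forall z, a < z < b -> is_derive z 1 F (g z)) ->
  (forall z, a < z < b -> is_derive z 1 g (dg z)) ->
  (forall x y, a < x < b -> a < y < b -> `|dg y - dg x| <= K * `|y - x|) ->
  forall x h, a < x < b -> a < x + h < b ->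
  `|F (x + h) - F x - h * g x - h ^+ 2 / 2 * dg x| <= K * `|h| ^+ 3.
Proof.
move=> K0 FP dgP dgK x h xab yab.
pose G z := F z - F x - (z - x) * g x - (z - x) ^+ 2 / 2 * dg x.
pose dG z := g z - g x - (z - x) * dg x.
have GP z : a < z < b -> is_derive z 1 G (dG z).
  move=> zab; have Fz := FP _ zab; 
  pose G' := F - cst (F x) - (id - cst x) * cst (g x)
             - (id - cst x) ^+ 2 * cst (2^-1 * dg x) : R -> R.
  have -> : G = G'.
    by apply/funext => u; rewrite /G /G' !fctE /= !expr2; ring.
  apply: is_derive_eq; rewrite /dG /= !fctE /= /GRing.scale /=.
  by field.
have [c [cab cx]] := @MVT_between R G dG a b x (x + h) GP xab yab.
have E : x + h - x = h by ring.
have -> : G x = 0 by rewrite /G; ring.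
rewrite /G /dG E subr0 in cx * => ->; rewrite normrM.
have cxE : x + (c - x) = c by ring.
have := @taylor1_lipschitz R a b K g dg K0 dgP dgK x (c - x) xab.
rewrite cxE => /(_ cab) T.
rewrite exprSr mulrA; apply: ler_wpM2r => //; apply: le_trans T _.
by apply: ler_wpM2l => //; rewrite -real_normK ?num_real //; apply: lerXn2r.
Qed.

(** Two first order expansions about the middle point [y], whose linear terms cancel. *)
Lemma second_difference_lipschitz (R : realType) (a b K : R) (g dg : R -> R) :
  0 <= K -> (forall z, a < z < b -> is_derive z 1 g (dg z)) ->
  (forall x y, a < x < b -> a < y < b -> `|dg y - dg x| <= K * `|y - x|) ->
  forall x y z, a < x < b -> a < y < b -> a < z < b -> y - x = z - y ->
  `|2 * g y - g z - g x| <= 2 * K * (y - x) ^+ 2.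
Proof.
move=> K0 dgP dgK x y z xab yab zab xyz.
have T := @taylor1_lipschitz R a b K g dg K0 dgP dgK y.
have := T (z - y) yab; rewrite addrC subrK => /(_ zab) T1.
have := T (x - y) yab; rewrite addrC subrK => /(_ xab) T2.
have -> : 2 * g y - g z - g x =
    - (g z - g y - (z - y) * dg y) - (g x - g y - (x - y) * dg y).
  by rewrite -xyz; ring.
apply: le_trans (ler_normB _ _) _; rewrite normrN.
apply: le_trans (lerD T1 T2) _; rewrite -xyz -[x - y]opprB sqrrN.
by rewrite le_eqVlt; apply/orP; left; apply/eqP; ring.
Qed.

(** On one cell of length [h = 1 / n], the sampled value minus [n] times the increment of [F] is
    [(eps - 1/2) * h * l] up to [O(h ^+ 2)], and so is [eps - 1/2] times the increment of [L]. The
    differences telescope to [O(h)]. *)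
Lemma shifted_riemann_sum (R : realType) (a b eps : R) (F L l : R -> R) :
  a < 0 -> 1 < b ->
  (forall z, a < z < b -> is_derive z 1 F (L z)) ->
  (forall z, a < z < b -> is_derive z 1 L (l z)) ->
  lipschitz_oo R a b l ->
  exists2 K : R, 0 <= K & forall n : nat, (0 < n)%N ->
    (forall i, (i < n)%N -> a < (i%:R + eps) / n%:R < b) ->
    `|\sum_(i < n) L ((i%:R + eps) / n%:R) - n%:R * (F 1 - F 0)
      - (eps - 2^-1) * (L 1 - L 0)| <= K / n%:R.
Proof.
move=> a0 b1 FP LP [K K0 lK].
have T1 := @taylor1_lipschitz R a b K L l K0 LP lK.
have T2 := @taylor2_lipschitz R a b K F L l K0 FP LP lK.
pose K' := K * (eps ^+ 2 + 1 + `|eps - 2^-1|).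
have K'0 : 0 <= K' by rewrite mulr_ge0 // !addr_ge0 // sqr_ge0.
exists K' => // n n0 xab.
have nR0 : 0 < n%:R :> R by rewrite ltr0n.
pose h : R := n%:R^-1; have h0 : 0 < h by rewrite invr_gt0.
have nh : n%:R * h = 1 by rewrite divff // gt_eqF.
pose y k : R := k%:R / n%:R.
have yab k : (k <= n)%N -> a < y k < b.
  move=> kn; have : 0 <= y k <= 1.
    by rewrite divr_ge0 //= ler_pdivrMr // mul1r ler_nat.
  by lra.
pose g k := \sum_(i < k) L ((i%:R + eps) / n%:R) - n%:R * F (y k)
            - (eps - 2^-1) * L (y k).
(* The geometric term of [telescoping_geometric_bound] is taken to be zero. *)
have gS k : (k < n)%N -> `|g k.+1 - g k| <= K' * h ^+ 2 + 0 * 0 ^+ k.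
  move=> kn; rewrite mul0r addr0 /g big_ord_recr /=.
  have ykab := yab _ (ltnW kn).
  have yS : y k.+1 = y k + h by rewrite /y -natr1 mulrDl mul1r.
  have yE : (k%:R + eps) / n%:R = y k + eps * h by rewrite /y mulrDl.
  have := yab _ kn; have := xab _ kn; rewrite yS yE => xkab yhab.
  have A1 := T1 _ _ ykab xkab.
  have A2 := T1 _ _ ykab yhab.
  have A3 := T2 _ _ ykab yhab.
  set S := \sum_(i < k) _.
  (* Taylor remainders at [y k]. The polynomial parts cancel up to a multiple of [1 - n * h = 0];
     the three terms of [K'] bound [u1], [n * u3] and [(eps - 1/2) * u2]. *)
  pose u1 := L (y k + eps * h) - L (y k) - eps * h * l (y k).
  pose u2 := L (y k + h) - L (y k) - h * l (y k).
  pose u3 := F (y k + h) - F (y k) - h * L (y k) - h ^+ 2 / 2 * l (y k).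
  have -> : S + L (y k + eps * h) - n%:R * F (y k + h) -
     (eps - 2^-1) * L (y k + h) - (S - n%:R * F (y k) - (eps - 2^-1) * L (y k))
     = u1 - n%:R * u3 - (eps - 2^-1) * u2
       + (1 - n%:R * h) * (L (y k) + h / 2 * l (y k)).
    by rewrite /u1 /u2 /u3; field.
  rewrite nh subrr mul0r addr0.
  apply: le_trans (ler_normB _ _) _.
  apply: le_trans (lerD (ler_normB _ _) (lexx _)) _.
  have -> : K' * h ^+ 2 = K * (eps * h) ^+ 2 + n%:R * h * (K * h ^+ 2)
       + `|eps - 2^-1| * (K * h ^+ 2) by rewrite nh /K'; ring.
  apply: lerD; first apply: lerD; first exact: A1.
    rewrite normrM (ger0_norm (ltW nR0)) -mulrA; apply: ler_wpM2l; first exact: ltW.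
    apply: le_trans A3 _; rewrite (ger0_norm (ltW h0)).
    by rewrite le_eqVlt; apply/orP; left; apply/eqP; ring.
  by rewrite normrM; apply: ler_wpM2l.
have := @telescoping_geometric_bound R 0 (K' * h ^+ 2) 0 n g _ gS.
rewrite mul0r addr0 eq_sym oner_eq0 => /(_ isT).
have -> : n%:R * (K' * h ^+ 2) = K' * h * (n%:R * h) by ring.
rewrite nh mulr1; apply: le_trans.
rewrite /g big_ord0 /y mul0r divff ?gt_eqF // le_eqVlt; apply/orP; left; apply/eqP.
by congr (`|_|); ring.
Qed.

(** * The characteristic root *)

(* The root larger than 1 of [X ^ 2 - t X + 1]. *)
Definition symbol_root (R : realType) (t : R) : R := (t + Num.sqrt (t ^+ 2 - 4)) / 2.

Lemma symbol_root_gt (R : realType) (t : R) : 2 < t -> t / 2 < symbol_root R t.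
Proof.
move=> t2; have : 0 < Num.sqrt (t ^+ 2 - 4) by rewrite sqrtr_gt0; nra.
by rewrite /symbol_root; lra.
Qed.

Lemma symbol_root_invD (R : realType) (t : R) : 2 < t ->
  t = (symbol_root R t)^-1 + symbol_root R t.
Proof.
move=> t2; have r := @symbol_root_gt R t t2.
have : Num.sqrt (t ^+ 2 - 4) ^+ 2 = t ^+ 2 - 4 by rewrite sqr_sqrtr //; nra.
move: r; rewrite /symbol_root; set s := Num.sqrt _ => r sE.
have : t * ((t + s) / 2) = 1 + ((t + s) / 2) ^+ 2.
  have -> : ((t + s) / 2) ^+ 2 = (t ^+ 2 + 2 * t * s + s ^+ 2) / 4 by field.
  by rewrite sE; field.
move: r; set r := (t + s) / 2 => r0 tr; have rn0 : r != 0 by lra.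
by apply: (@mulIf _ r) => //; rewrite tr; field.
Qed.

(** With [s = sqrt (f ^+ 2 - 4)] and [r = (f + s) / 2], the derivative of [r] is [f' * r / s], so
    the logarithmic derivative is just [f' / s]. *)
Lemma is_derive_ln_symbol_root (R : realType) (f : R -> R) (x df : R) :
  2 < f x -> is_derive x 1 f df ->
  is_derive x 1 (fun z => ln (symbol_root R (f z))) (df * (Num.sqrt (f x ^+ 2 - 4))^-1).
Proof.
move=> f2 fP; have s0 : 0 < f x ^+ 2 - 4 by nra.
have r0 : 0 < symbol_root R (f x) by have := @symbol_root_gt R _ f2; lra.
have Dh : is_derive x 1 (fun z => f z ^+ 2 - 4) (2 * f x * df).
  have -> : (fun z => f z ^+ 2 - 4) = f ^+ 2 - cst 4 :> (R -> R).
    by apply/funext => u; rewrite !fctE.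
  by apply: is_derive_eq; rewrite /GRing.scale /= expr1; ring.
have Ds := @is_derive1_comp R Num.sqrt (fun z => f z ^+ 2 - 4) x _ _
  (is_derive1_sqrt s0) Dh.
have Dr : is_derive x 1 (fun z => symbol_root R (f z))
    ((df + (2 * Num.sqrt (f x ^+ 2 - 4))^-1 * (2 * f x * df)) * 2^-1).
  have -> : (fun z => symbol_root R (f z)) =
      (f + (Num.sqrt \o (fun z => f z ^+ 2 - 4))) * cst 2^-1 :> (R -> R).
    by apply/funext => u; rewrite !fctE.
  by apply: is_derive_eq; rewrite /GRing.scale /=; ring.
have := @is_derive1_comp R (@ln R) (fun z => symbol_root R (f z)) x _ _
  (is_derive1_ln r0) Dr.
move=> H; apply: (is_derive_eq H).
have : 0 < Num.sqrt (f x ^+ 2 - 4) by rewrite sqrtr_gt0.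
move: r0; rewrite /symbol_root; set s := Num.sqrt _ => r0 sp.
by field; apply/andP; split; lra.
Qed.

Lemma symbol_root_ln_lipschitz (R : realType) (a b tau : R) (f df : R -> R) :
  a < b -> 0 < tau ->
  (forall z, a < z < b -> 2 + tau <= f z) ->
  (forall z, a < z < b -> is_derive z 1 f (df z)) ->
  lipschitz_oo R a b df ->
  lipschitz_oo R a b (fun z => df z * (Num.sqrt (f z ^+ 2 - 4))^-1).
Proof.
move=> ab tau0 ftau fP dfL.
have fL : lipschitz_oo R a b f.
  by apply: (@bounded_derive_lipschitz R a b f df fP); exact: lipschitz_bounded.
apply: lipschitz_mul => //.
apply: (@lipschitz_inv_sqrt R a b tau) => //.
  (* [(2 + tau) ^+ 2 - 4 = 4 * tau + tau ^+ 2 >= tau]. *)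
  by move=> x /ftau fx; nra.
have [K K0 gK] := @lipschitz_mul R a b f f ab fL fL.
exists K => // x y xab yab; have := gK _ _ xab yab.
by rewrite -!expr2 opprB addrA subrK.
Qed.

Lemma is_derive_symbol_root_inv (R : realType) (f : R -> R) (x df : R) :
  2 < f x -> is_derive x 1 f df ->
  is_derive x 1 (fun z => expR (- ln (symbol_root R (f z))))
    (- (expR (- ln (symbol_root R (f x))) * (df * (Num.sqrt (f x ^+ 2 - 4))^-1))).
Proof.
move=> f2 fP; have LP := @is_derive_ln_symbol_root R f x df f2 fP.
have NP := is_deriveN LP.
have := @is_derive1_comp R expR (- (fun z => ln (symbol_root R (f z)))) x _ _ (is_derive_expR _) NP.
by move=> H; apply: (is_derive_eq H); rewrite mulrN.
Qed.

(** Here [m = 1 / r] is written [expR (- ln r)], so that [m' = - m * l] with [l = (ln r)']. As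
    [m <= 1] and [l] is bounded, [m] is Lipschitz; then so is the product [m * l]. *)
Lemma symbol_root_inv_lipschitz (R : realType) (a b tau : R) (f df : R -> R) :
  a < b -> 0 < tau ->
  (forall z, a < z < b -> 2 + tau <= f z) ->
  (forall z, a < z < b -> is_derive z 1 f (df z)) ->
  lipschitz_oo R a b df ->
  lipschitz_oo R a b (fun z => expR (- ln (symbol_root R (f z)))) /\
  lipschitz_oo R a b (fun z => - (expR (- ln (symbol_root R (f z))) *
     (df z * (Num.sqrt (f z ^+ 2 - 4))^-1))).
Proof.
move=> ab tau0 ftau fP dfL.
have lL := @symbol_root_ln_lipschitz R a b tau f df ab tau0 ftau fP dfL.
have [Bl Bl0 lB] := @lipschitz_bounded _ _ _ _ ab lL.
have f2 z : a < z < b -> 2 < f z by move=> /ftau; lra.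
have mP z (zab : a < z < b) :=
  @is_derive_symbol_root_inv R f z (df z) (f2 _ zab) (fP _ zab).
have mL : lipschitz_oo R a b (fun z => expR (- ln (symbol_root R (f z)))).
  apply: (@bounded_derive_lipschitz R a b _ (fun z => - (expR (- ln (symbol_root R (f z))) *
     (df z * (Num.sqrt (f z ^+ 2 - 4))^-1))) mP); exists Bl => // z zab.
  rewrite normrN normrM -[leRHS]mul1r; apply: ler_pM => //; last exact: lB.
  rewrite ger0_norm ?expR_ge0 // -expR0 ler_expR oppr_le0 ln_ge0 //.
  by have := @symbol_root_gt R _ (f2 _ zab); have := f2 _ zab; lra.
split => //; have [K K0 gK] := @lipschitz_mul R a b _ _ ab mL lL.
exists K => // x y xab yab; have := gK _ _ xab yab.
by rewrite -normrN opprB opprK addrC.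
Qed.

(** [F] is the integral from [u], where [[u, v]] inside []a, b[] makes [g] integrable. Starting left
    of the points of interest gives a derivative on an open interval around them. *)
Lemma primitive_Rintegral (R : realType) (a b u v : R) (g : R -> R) :
  a < u -> u < v -> v < b ->
  (forall z, a < z < b -> {for z, continuous g}) ->
  exists2 F : R -> R, forall z, u < z < v -> is_derive z 1 F (g z) &
    forall x y, u < x -> x < y -> y < v ->
      Rintegral (@lebesgue_measure R) `[x, y] g = F y - F x.
Proof.
move=> au uv vb cg.
have cuv x y : a < x -> y < b -> {within `[x, y], continuous g}.
  move=> ax yb; apply: continuous_in_subspaceT => z.
  by rewrite inE /= in_itv /= => zuv; apply: cg; lra.
have ig : (@lebesgue_measure R).-integrable `[u, v] (EFin \o g).
  by apply: continuous_compact_integrable; [exact: segment_compact | exact: cuv].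
pose F x := Rintegral (@lebesgue_measure R) `[u, x] g.
have FP z : u < z < v -> is_derive z 1 F (g z).
  move=> /andP[uz zv].
  have cz : {for z, continuous g} by apply: cg; lra.
  have [|dF FE] := @continuous_FTC1 R g (BLeft u) z v zv ig _ cz.
    by rewrite /= lte_fin.
  by apply: (DeriveDef dF); rewrite -derive1E.
exists F => // x y ux xy yv.
have cF z : u < z < v -> {for z, continuous F}.
  by move=> /FP [dF _]; apply: differentiable_continuous; apply/derivable1_diffP.
have := @continuous_FTC2 R g F x y xy.
rewrite /Rintegral => ->; first by [].
- by apply: cuv; lra.
- split.
  + by move=> z; rewrite in_itv /= => zxy; have [] : is_derive z 1 F (g z) by apply: FP; lra.
  + by apply: cvg_at_right_filter; apply: cF; lra.
  + by apply: cvg_at_left_filter; apply: cF; lra.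
- move=> z; rewrite in_itv /= => zxy.
  by rewrite derive1E; apply: derive_val; apply: FP; lra.
Qed.

(** * Passage to the limit *)

Lemma cvg_natV (R : realType) : (fun n : nat => n%:R^-1 : R) @ \oo --> (0 : R).
Proof. by rewrite -cvg_shiftS; exact: cvg_harmonic. Qed.

Lemma harmonic_geometric_cvg (R : realType) (K rho l : R) (u : nat -> R) :
  0 <= rho < 1 ->
  (\forall n \near \oo, `|u n - l| <= K * (n%:R^-1 + rho ^+ n)) ->
  u @ \oo --> l.
Proof.
move=> /andP[rho0 rho1] uK.
have v0 : (fun n : nat => K * (n%:R^-1 + rho ^+ n) : R) @ \oo --> (0 : R).
  rewrite -[X in _ --> X](mulr0 K) -[X in _ --> K * X](addr0 0).
  apply: cvgM; first exact: cvg_cst.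
  apply: cvgD; first exact: cvg_natV.
  by apply: cvg_expr; rewrite ger0_norm.
apply: (@squeeze_cvgr _ _ _ _ (fun n => l - K * (n%:R^-1 + rho ^+ n))
   (fun n => l + K * (n%:R^-1 + rho ^+ n))).
- by apply: filterS uK => n; rewrite ler_distl.
- by rewrite -[X in _ --> X]subr0; apply: cvgB => //; exact: cvg_cst.
- by rewrite -[X in _ --> X]addr0; apply: cvgD => //; exact: cvg_cst.
Qed.

(** With [s = sqrt (t ^+ 2 - 4)] and [r] the root, [t + s = 2 * r] and [1 - r ^- 2 = s / r]. Both
    sides become exponentials of combinations of [ln 2], [L] and [ln s], and the exponents agree. *)
Lemma limit_closed_form (R : realType) (f0 f1 eps : R) : 2 < f0 -> 2 < f1 ->
  let L t := ln (symbol_root R t) in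
  let e t := Num.sqrt (1 - expR (- L t) ^+ 2) in
  expR ((eps - 2^-1) * (L f1 - L f0)) / (e f0 * e f1) =
  (powR (f0 + Num.Def.sqrtr (f0 ^+ 2 - 4)) (1 - eps) *
   powR (f1 + Num.Def.sqrtr (f1 ^+ 2 - 4)) eps) /
  (2 * powR ((f0 ^+ 2 - 4) * (f1 ^+ 2 - 4)) (4%:R^-1)).
Proof.
move=> f02 f12 L e.
pose s (t : R) := Num.sqrt (t ^+ 2 - 4).
have s0 t : 2 < t -> 0 < s t by move=> t2; rewrite sqrtr_gt0; nra.
have sE t : 2 < t -> t ^+ 2 - 4 = expR (2 * ln (s t)).
  move=> t2; rewrite expRM_natl lnK ?posrE ?s0 //.
  by rewrite sqr_sqrtr //; nra.
have r0 t : 2 < t -> 0 < symbol_root R t.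
  by move=> t2; have := @symbol_root_gt R t t2; lra.
have rE t : 2 < t -> t + s t = expR (ln 2 + L t).
  move=> t2; rewrite expRD !lnK ?posrE ?r0 // /symbol_root -/(s t).
  by rewrite mulrC divfK.
have eE t : 2 < t -> e t = expR (2^-1 * (ln (s t) - L t)).
  move=> t2; have rt := r0 _ t2.
  have -> : e t = Num.sqrt (expR (2^-1 * (ln (s t) - L t)) ^+ 2).
    congr Num.sqrt; rewrite -!expRM_natl mulrA divff ?pnatr_eq0 // mul1r.
    rewrite expRD expRM_natl !expRN !lnK ?posrE ?s0 ?r0 //.
    have -> : s t = symbol_root R t - (symbol_root R t)^-1.
      have tE := @symbol_root_invD R t t2.
      have : symbol_root R t = (t + s t) / 2 by [].
      by lra.
    by field; lra.
  by rewrite sqrtr_sqr ger0_norm // expR_ge0.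
rewrite !eE // -/(s f0) -/(s f1) !rE // !sE //.
rewrite -(expRD (2 * _)) /powR !gt_eqF ?expR_gt0 // !expRK.
have -> y : 2 * expR y = expR (ln 2 + y) :> R by rewrite expRD lnK ?posrE.
rewrite -!expRD -!expRN -!expRD; congr expR.
by field.
Qed.

(** The range of [k] includes one point before the first node and one after the last, as the
    recurrence requires. It suffices that [n * min (- a) (b - 1)] exceeds [|eps| + 1]. *)
Lemma near_nodes_in_itv (R : realType) (a b eps : R) : a < 0 -> 1 < b ->
  \forall n \near \oo, forall k : nat, (k <= n.+1)%N ->
    a < (k%:R - 1 + eps) / n%:R < b.
Proof.
move=> a0 b1; pose c := `|eps| + 1; pose de := Num.min (- a) (b - 1).
have de0 : 0 < de by rewrite lt_min; apply/andP; split; lra.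
near=> n => k kn.
have n0 : 0 < n%:R :> R by rewrite ltr0n; near: n; exact: nbhs_infty_gt.
have nde : c < n%:R * de by rewrite -ltr_pdivrMr //; near: n; exact: nbhs_infty_gtr.
have [dea deb] : de <= - a /\ de <= b - 1.
  by rewrite /de !ge_min !lexx orbT.
have e1 : - `|eps| <= eps <= `|eps| by rewrite -ler_norml.
have kR : 0 <= (k%:R : R) <= n%:R + 1 by rewrite ler0n natr1 ler_nat.
rewrite ltr_pdivlMr // ltr_pdivrMr //.
have : n%:R * de <= n%:R * - a by rewrite ler_pM2l.
have : n%:R * de <= n%:R * (b - 1) by rewrite ler_pM2l.
by move: nde; rewrite /c; lra.
Unshelve. all: by end_near.
Qed.

Lemma det_tridiag_sampled_asymptotics (R : realType) (a b eps rho : R)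
    (m dm : R -> R) (f : R -> R) :
  a < 0 -> 1 < b -> 0 <= rho < 1 ->
  (forall z, a < z < b -> 0 < m z <= rho) ->
  (forall z, a < z < b -> f z = m z + (m z)^-1) ->
  (forall z, a < z < b -> is_derive z 1 m (dm z)) ->
  lipschitz_oo R a b m -> lipschitz_oo R a b dm ->
  (fun n : nat => \det (tridiag R (fun i => f ((i%:R + eps) / n%:R)) n) *
     \prod_(i < n) m ((i%:R + eps) / n%:R)) @ \oo -->
  ((Num.sqrt (1 - m 0 ^+ 2) * Num.sqrt (1 - m 1 ^+ 2))^-1 : R).
Proof.
move=> a0 b1 rho01 mrho fm mP [K1 K10 mK] [K2 K20 dmK].
pose x n k : R := (k%:R - 1 + eps) / n%:R.
have xS n k : x n k.+1 = (k%:R + eps) / n%:R by rewrite /x -natr1 addrK.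
pose D n := \det (tridiag R (fun i => f ((i%:R + eps) / n%:R)) n).
pose E z : R := Num.sqrt (1 - m z ^+ 2).
pose A n : R := D n * \prod_(i < n) m ((i%:R + eps) / n%:R).
pose P n : R := E (x n 0%N) * E (x n n).
have nodes := @near_nodes_in_itv R a b eps a0 b1.
(* One constant serves both for first differences of [m] ([K1]) and for second differences
   ([2 * K2]). *)
have C0 : 0 <= K1 + 2 * K2 by lra.
have AP : (fun n => A n * P n) @ \oo --> (1 : R).
  have [K K0 KP] := @amplitude_asymptotics R rho (K1 + 2 * K2) rho01 C0.
  apply: (@harmonic_geometric_cvg R K rho _ _ rho01).
  near=> n.
  have xab : forall k, (k <= n.+1)%N -> a < x n k < b by near: n.
  have n0 : (0 < n)%N by near: n; exact: nbhs_infty_gt.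
  have nR0 : 0 < n%:R :> R by rewrite ltr0n.
  have h0 : 0 <= n%:R^-1 :> R by rewrite invr_ge0.
  have nh : n%:R / n%:R = 1 :> R by rewrite divff // gt_eqF.
  have xd k : x n k.+1 - x n k = n%:R^-1.
    by rewrite /x -natr1; field; lra.
  pose aa k := \det (tridiag R (fun i => f ((i%:R + eps) / n%:R)) k) *
               \prod_(i < k) m (x n i.+1).
  pose d k := if k is j.+1 then aa k - aa j else 1.
  have -> : A n = aa n.
    by congr (_ * _); apply: eq_bigr => i _; rewrite xS.
  apply: (KP n n%:R^-1 (fun k => m (x n k)) aa d) => //.
  - by move=> k /xab /mrho /andP[/ltW -> ->].
  - move=> k kn; have kn1 : (k <= n.+1)%N by exact: leqW.
    apply: le_trans (mK _ _ (xab _ kn1) (xab _ _)) _ => //.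
    rewrite xd ger0_norm // ler_wpM2r //; lra.
  - move=> k kn; have kn1 : (k.+1 <= n.+1)%N by exact: leqW.
    have := @second_difference_lipschitz R a b K2 m dm K20 mP dmK _ _ _
      (xab _ (ltnW kn1)) (xab _ kn1) (xab k.+2 kn).
    rewrite !xd => /(_ erefl) /le_trans; apply.
    by rewrite ler_wpM2r ?sqr_ge0 //; lra.
  - by rewrite /aa det_mx00 big_ord0 mulr1.
  - by move=> k kn; rewrite /d addrC subrK.
  - move=> k kn; apply: (@det_tridiag_amplitude R _ (fun k => m (x n k)) n) kn.
    + by move=> j jn; have /mrho/andP[/gt_eqF -> //] := xab _ (leqW jn).
    + by move=> j jn; rewrite -xS fm // xab // leqW.
(* Continuity of [E] moves the limit from the points [x n 0] and [x n n] to [0] and [1]. *)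
have cE z : a < z < b -> {for z, continuous E}.
  move=> zab; have [dmz _] := mP _ zab.
  have cm : {for z, continuous m}.
    by apply: differentiable_continuous; apply/derivable1_diffP.
  have cg : (fun u => 1 - m u ^+ 2) @ z --> 1 - m z ^+ 2.
    by apply: cvgB; [exact: cvg_cst|rewrite !expr2; exact: cvgM].
  by apply: continuous_cvg; [exact: sqrt_continuous|exact: cg].
have x0 : (fun n => x n 0%N) @ \oo --> (0 : R).
  rewrite -[X in _ --> X](mulr0 (0 - 1 + eps)); apply: cvgM; first exact: cvg_cst.
  exact: cvg_natV.
have x1 : (fun n => x n n) @ \oo --> (1 : R).
  have : (fun n => 1 + (eps - 1) * n%:R^-1 : R) @ \oo --> (1 : R).
    rewrite -[X in _ --> X]addr0 -[X in _ --> _ + X](mulr0 (eps - 1)).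
    apply: cvgD; first exact: cvg_cst.
    by apply: cvgM; [exact: cvg_cst|exact: cvg_natV].
  apply: cvg_trans; apply: near_eq_cvg; near=> n.
  have n0 : (n%:R : R) != 0.
    by rewrite pnatr_eq0 -lt0n; near: n; exact: nbhs_infty_gt.
  by rewrite /x; field.
have P01 : P @ \oo --> E 0 * E 1.
  apply: cvgM; first by apply: (cvg_comp _ _ x0); apply: cE; lra.
  by apply: (cvg_comp _ _ x1); apply: cE; lra.
have E0 z : a < z < b -> 0 < E z.
  by move=> /mrho/andP[m0 m1]; rewrite sqrtr_gt0; case/andP: rho01 => *; nra.
have EE0 : E 0 * E 1 != 0.
  by rewrite mulf_neq0 // gt_eqF // E0 //; lra.
have APP : (fun n => A n * P n * (P n)^-1 : R) @ \oo --> ((E 0 * E 1)^-1 : R).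
  by rewrite -[X in _ --> X]mul1r; apply: cvgM => //; exact: cvgV.
apply: cvg_trans APP; apply: near_eq_cvg; near=> n.
have xab : forall k, (k <= n.+1)%N -> a < x n k < b by near: n.
have Pn : P n != 0 by rewrite mulf_neq0 // gt_eqF // E0 // xab.
by rewrite mulfK.
Unshelve. all: by end_near.
Qed.

Theorem theorem1p2 (R : realType) (a b : R) (f : R -> R) (eps : R) :
  a < 0 -> 1 < b ->
  (forall x, x \in `]a, b[ -> derivable f x 1) ->
  (forall x, x \in `]a, b[ -> derivable (derive1 f) x 1) ->
  (exists M : R, forall x, x \in `]a, b[ -> `|derive1n 2 f x| <= M) ->
  (forall x, x \in `]a, b[ -> 2 < f x) ->
  (fun n : nat => \det (Tmat f eps n) / Gf f ^+ n) @ \oo -->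
    ((powR (f 0 + Num.Def.sqrtr (f 0 ^+ 2 - 4)) (1 - eps) *
     powR (f 1 + Num.Def.sqrtr (f 1 ^+ 2 - 4)) eps) /
    (2 * powR ((f 0 ^+ 2 - 4) * (f 1 ^+ 2 - 4)) (4%:R^-1)) : R).
Proof.
move=> a0 b1 df ddf [M ddfM] f2'.
have ab : a < b by lra.
have itvE z : (z \in `]a, b[) = (a < z < b) by rewrite ?mem_setE in_itv.
have f2 z : a < z < b -> 2 < f z by rewrite -itvE; exact: f2'.
have fP z : a < z < b -> is_derive z 1 f (derive1 f z).
  by rewrite -itvE => /df dfz; apply: (DeriveDef dfz); rewrite derive1E.
have dfP z : a < z < b -> is_derive z 1 (derive1 f) (derive1n 2 f z).
  by rewrite -itvE => /ddf dfz; apply: (DeriveDef dfz); rewrite /= derive1E.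
have dfL : lipschitz_oo R a b (derive1 f).
  apply: (@bounded_derive_lipschitz R a b _ _ dfP).
  exists `|M| => // z; rewrite -itvE => /ddfM /le_trans; apply; exact: ler_norm.
(* A smaller interval []u, v[] still containing [[0, 1]]: on the compact [[u, v]] the minimum of [f]
   exceeds [2], which yields the uniform gap [tau]. *)
pose u := a / 2; pose v := (1 + b) / 2.
have u0 : u < 0 by rewrite /u; lra.
have v1 : 1 < v by rewrite /v; lra.
have au : a < u by rewrite /u; lra.
have vb : v < b by rewrite /v; lra.
have uv : u < v by lra.
have sub z : u < z < v -> a < z < b by lra.
have [tau tau0 ftau] : exists2 tau, 0 < tau & forall z, u < z < v -> 2 + tau <= f z.
  have [||c cuv fc] := @EVT_min R f u v; first exact: ltW.
    apply: derivable_within_continuous => z; rewrite in_itv /= => zuv.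
    by apply: df; rewrite itvE; lra.
  have f2c : 2 < f c by apply: f2; move: cuv; rewrite in_itv /=; lra.
  exists (f c - 2); first by lra.
  by move=> z zuv; rewrite addrC subrK fc // in_itv /=; lra.
have fPuv z (zuv : u < z < v) := fP _ (sub _ zuv).
have dfLuv : lipschitz_oo R u v (derive1 f).
  by case: dfL => K K0 gK; exists K => // x y xuv yuv; apply: gK; exact: sub.
pose L z : R := ln (symbol_root R (f z)).
pose l z : R := derive1 f z * (Num.sqrt (f z ^+ 2 - 4))^-1.
pose m z : R := expR (- L z).
have LP z : a < z < b -> is_derive z 1 L (l z).
  by move=> zab; exact: is_derive_ln_symbol_root (f2 _ zab) (fP _ zab).
have lL : lipschitz_oo R u v l.
  exact: symbol_root_ln_lipschitz uv tau0 ftau fPuv dfLuv.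
have [mL dmL] : lipschitz_oo R u v m /\ lipschitz_oo R u v (fun z => - (m z * l z)).
  exact: symbol_root_inv_lipschitz uv tau0 ftau fPuv dfLuv.
have mP z : u < z < v -> is_derive z 1 m (- (m z * l z)).
  by move=> /sub zab; exact: is_derive_symbol_root_inv (f2 _ zab) (fP _ zab).
have r0 z : a < z < b -> 0 < symbol_root R (f z).
  by move=> zab; have := @symbol_root_gt R _ (f2 _ zab); have := f2 _ zab; lra.
have mE z : a < z < b -> m z = (symbol_root R (f z))^-1.
  by move=> zab; rewrite /m /L expRN lnK // posrE r0.
have fm z : u < z < v -> f z = m z + (m z)^-1.
  by move=> /sub zab; rewrite mE // invrK; apply: symbol_root_invD; exact: f2.
(* The root exceeds [f / 2 >= 1 + tau / 2]. *)
pose rho := (1 + tau / 2)^-1.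
have rho01 : 0 <= rho < 1.
  by rewrite invr_ge0 invf_lt1; lra.
have mrho z : u < z < v -> 0 < m z <= rho.
  move=> zuv; have zab := sub _ zuv; rewrite expR_gt0 /= mE // lef_pV2 ?posrE ?r0 //.
    by have := @symbol_root_gt R _ (f2 _ zab); have := ftau _ zuv; lra.
  by lra.
have [F FP FI] : exists2 F : R -> R, forall z, u < z < v -> is_derive z 1 F (L z) &
    forall x y, u < x -> x < y -> y < v ->
      Rintegral (@lebesgue_measure R) `[x, y] L = F y - F x.
  apply: primitive_Rintegral au uv vb _ => z /LP [dL _].
  by apply: differentiable_continuous; apply/derivable1_diffP.
have GE : Gf f = expR (F 1 - F 0) by rewrite /Gf -FI //; lra.
pose S n := \sum_(i < n) L ((i%:R + eps) / n%:R) - n%:R * (F 1 - F 0).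
have Scvg : S @ \oo --> ((eps - 2^-1) * (L 1 - L 0) : R).
  have LPuv z (zuv : u < z < v) := LP _ (sub _ zuv).
  have [K K0 KP] := @shifted_riemann_sum R u v eps F L l u0 v1 FP LPuv lL.
  have rho00 : 0 <= (0 : R) < 1 by rewrite lexx ltr01.
  apply: (@harmonic_geometric_cvg R K 0 _ _ rho00).
  have nodes := @near_nodes_in_itv R u v eps u0 v1.
  near=> n.
  have n0 : (0 < n)%N by near: n; exact: nbhs_infty_gt.
  have xuv : forall k : nat, (k <= n.+1)%N -> u < (k%:R - 1 + eps) / n%:R < v.
    by near: n.
  rewrite expr0n eqn0Ngt n0 addr0; apply: KP => // i i_n.
  have := xuv i.+1 (leqW i_n); rewrite -natr1 addrK; exact.
have Acvg := @det_tridiag_sampled_asymptotics R u v eps rho m _ f u0 v1 rho01 mrho fm mP mL dmL.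
have u01 : u < 0 < v by lra.
have u11 : u < 1 < v by lra.
rewrite -limit_closed_form; [|by apply: f2; lra..].
rewrite mulrC.
(* The product of the [m] is [expR] of minus the sum of the [L], so it cancels the sum in
   [expR (S n)]; what is left is [expR (- n * (F 1 - F 0))], the inverse of [Gf f ^+ n]. *)
have -> : (fun n : nat => \det (Tmat f eps n) / Gf f ^+ n) =
  (fun n => (\det (tridiag R (fun i => f ((i%:R + eps) / n%:R)) n) *
     \prod_(i < n) m ((i%:R + eps) / n%:R)) * expR (S n)).
  apply/funext => n; rewrite GE -expRM_natl /S expRD expRN mulrA.
  congr (_ / _); rewrite -mulrA -expR_sum -expRD.
  rewrite sumrN addNr expR0 mulr1; reflexivity.
apply: cvgM; first exact: Acvg.
by apply: continuous_cvg => //; exact: continuous_expR.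
Unshelve. all: by end_near.
Qed.
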